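(* Let $E$ be a truncated normed Riesz space with norm $\|\cdot\|$ and let $\|\cdot\|_{u}$ be a unitization norm on $E\oplus\mathbb{R}$. If $E$ is dense in $(E\oplus\mathbb{R},\|\cdot\|_{u})$, then $E$ has no truncation unit and $\|\cdot\|_{u}=\|\cdot\|_{0}$, where $$\|x+\alpha\|_{0}=\sup\left\{\|y\|: y\in E\text{ and }|y|\leq|x+\alpha|\right\},\qquad x\in E,\ \alpha\in\mathbb{R}.$$
   Context: All Riesz spaces are real. A truncated Riesz space is a nonzero Riesz space $E$ together with a truncation, i.e. a nonzero map $x\mapsto x^{*}$ from the positive cone $E^{+}$ into itself such that $x\wedge y^{*}\leq x^{*}\leq x$ for all $x,y\in E^{+}$. A truncation unit is an element $e>0$ of $E$ such that $x^{*}=e\wedge x$ for all $x\in E^{+}$. Unitization: the vector space direct sum $E\oplus\mathbb{R}$ (elements written $x+\alpha$ with $x\in E$, $\alpha\in\mathbb{R}$; $1$ denotes $0+1$; $x\in E$ is identified with $x+0$) is a Riesz space whose absolute value is given by $|x+0|=|x|$ and, for $\alpha\neq 0$, $|x+\alpha|=|x|-2|\alpha|\left(\tfrac{1}{\alpha}x^{-}\vee\tfrac{-1}{\alpha}x^{+}\right)^{*}+|\alpha|$. Equivalently, $x+\alpha\geq 0$ if and only if either $\alpha=0$ and $x\geq 0$, or $\alpha>0$ and $\left(\tfrac1\alpha x^{-}\right)^{*}=\tfrac1\alpha x^{-}$. For this structure (known from earlier work) $E$ is a Riesz subspace of $E\oplus\mathbb{R}$ and $x^{*}=1\wedge x$ for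 all $x\in E^{+}$. A lattice norm on a Riesz space is a norm such that $|u|\leq|v|$ implies $\|u\|\leq\|v\|$. A truncated normed Riesz space is a truncated Riesz space $E$ with a lattice norm $\|\cdot\|$ for which the truncation is norm-bounded; as a standing normalization, $\sup\{\|x^{*}\|:x\in E^{+}\}=1$. A unitization norm on $E\oplus\mathbb{R}$ is a lattice norm $\|\cdot\|_u$ on $E\oplus\mathbb{R}$ extending $\|\cdot\|$ (i.e. $\|x\|_u=\|x\|$ for $x\in E$) with $\|1\|_u=1$. *)

(* Defs.v *)
From HB Require Import structures.
From mathcomp Require Import all_boot all_order all_algebra.
From mathcomp Require Import boolp classical_sets reals.

Set Implicit Arguments.
Unset Strict Implicit.
Unset Printing Implicit Defensive.

Import Order.TTheory GRing.Theory Num.Theory.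
Local Open Scope classical_set_scope.
Local Open Scope ring_scope.

(* The lattice operations are part of this mixin, stated as in
   Order.POrder_MeetJoin_isLattice, because Hierarchy Builder cannot join
   Order.Lattice and GRing.Zmodule below Num.RealDomain. *)
HB.mixin Record isRiesz (R : realType) E
    of GRing.Lmodule R E & Order.POrder ring_display E := {
  rz_lerD2r : forall z x y : E, x <= y -> x + z <= y + z;
  rz_scale_ge0 : forall (a : R) (x : E), 0 <= a -> 0 <= x -> 0 <= a *: x;
  rmeet : E -> E -> E;
  rjoin : E -> E -> E;
  rmeetP : forall x y z : E, (x <= rmeet y z) = (x <= y) && (x <= z);
  rjoinP : forall x y z : E, (rjoin x y <= z) = (x <= z) && (y <= z)
}.

#[short(type="rieszType")]
HB.structure Definition Riesz (R : realType) :=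
  { E of GRing.Lmodule R E & Order.POrder ring_display E & isRiesz R E }.

Arguments rz_scale_ge0 {R s a x}.

Section RieszOps.
Context {R : realType} {E : rieszType R}.
Implicit Types x y : E.

Definition rpos x : E := rjoin x 0.
Definition rneg x : E := rjoin (- x) 0.
Definition rabs x : E := rjoin x (- x).

Lemma rz_leUl x y : x <= rjoin x y.
Proof. by have := lexx (rjoin x y); rewrite rjoinP => /andP[]. Qed.
Lemma rz_leUr x y : y <= rjoin x y.
Proof. by have := lexx (rjoin x y); rewrite rjoinP => /andP[]. Qed.
Lemma rz_leIl x y : rmeet x y <= x.
Proof. by have := lexx (rmeet x y); rewrite rmeetP => /andP[]. Qed.
Lemma rz_leIr x y : rmeet x y <= y.
Proof. by have := lexx (rmeet x y); rewrite rmeetP => /andP[]. Qed.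

Lemma rjoinC x y : rjoin x y = rjoin y x.
Proof. by apply: le_anti; rewrite !rjoinP !rz_leUl !rz_leUr. Qed.
Lemma rjoin_l x y : y <= x -> rjoin x y = x.
Proof. by move=> yx; apply: le_anti; rewrite rjoinP rz_leUl lexx yx. Qed.
Lemma rmeet_l x y : x <= y -> rmeet x y = x.
Proof. by move=> xy; apply: le_anti; rewrite rmeetP rz_leIl lexx xy. Qed.
Lemma rmeet_r x y : y <= x -> rmeet x y = y.
Proof. by move=> yx; apply: le_anti; rewrite rmeetP rz_leIr lexx yx. Qed.

End RieszOps.

(* A truncation is a map E^+ -> E^+; it is encoded as a total function whose
   values outside the positive cone are irrelevant. *)
HB.mixin Record hasTruncation (R : realType) E of Riesz R E := {
  trunc : E -> E;
  trunc_ge0 : forall x, 0 <= x -> 0 <= trunc x;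
  trunc_ge_meet : forall x y, 0 <= x -> 0 <= y -> rmeet x (trunc y) <= trunc x;
  trunc_le : forall x, 0 <= x -> trunc x <= x;
  trunc_neq0 : exists2 x, 0 <= x & trunc x != 0
}.

(* E <> 0 is implied by trunc_neq0. *)
#[short(type="truncRieszType")]
HB.structure Definition TruncRiesz (R : realType) :=
  { E of Riesz R E & hasTruncation R E }.

Definition is_truncation_unit {R : realType} {E : truncRieszType R} (e : E) :=
  0 < e /\ forall x : E, 0 <= x -> trunc x = rmeet e x.

Section RieszTheory.
Context {R : realType} {E : rieszType R}.
Implicit Types x y z : E.

Lemma rz_leD2 z x y : (x + z <= y + z) = (x <= y).
Proof.
apply/idP/idP => [/(rz_lerD2r (- z))|/(rz_lerD2r z)//].
by rewrite !addrK.
Qed.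

Lemma rz_subr_ge0 x y : (0 <= y - x) = (x <= y).
Proof. by rewrite -(rz_leD2 x 0) add0r subrK. Qed.

Lemma rz_addr_ge0 x y : 0 <= x -> 0 <= y -> 0 <= x + y.
Proof. by move=> x0 y0; apply: (le_trans y0); rewrite -{1}[y]add0r rz_leD2. Qed.

Lemma rz_leD x y z t : x <= y -> z <= t -> x + z <= y + t.
Proof.
rewrite -!(rz_subr_ge0 x y) -(rz_subr_ge0 z t) -(rz_subr_ge0 (x + z)) => h k.
by rewrite opprD addrACA rz_addr_ge0.
Qed.

Lemma rz_leN2 x y : (- x <= - y) = (y <= x).
Proof. by rewrite -(rz_subr_ge0 (- x)) opprK addrC rz_subr_ge0. Qed.

Lemma rz_scale_pos_ge0 (a : R) x : 0 < a -> (0 <= a *: x) = (0 <= x).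
Proof.
move=> a0; apply/idP/idP => [h|]; last exact/rz_scale_ge0/ltW.
have ai0 : 0 <= a^-1 by rewrite invr_ge0 ltW.
by have := rz_scale_ge0 ai0 h; rewrite scalerA mulVf ?gt_eqF// scale1r.
Qed.

Lemma rz_scale_le (a : R) x y : 0 < a -> (a *: x <= a *: y) = (x <= y).
Proof.
by move=> a0; rewrite -(rz_subr_ge0 (_ *: _)) -scalerBr rz_scale_pos_ge0// rz_subr_ge0.
Qed.

Lemma rz_scale_wle (a : R) x y : 0 <= a -> x <= y -> a *: x <= a *: y.
Proof.
rewrite -(rz_subr_ge0 x) -(rz_subr_ge0 (_ *: _)) -scalerBr.
exact: rz_scale_ge0.
Qed.

Lemma rjoinDr z x y : rjoin (x + z) (y + z) = rjoin x y + z.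
Proof.
apply: le_anti; rewrite rjoinP !rz_leD2 rz_leUl rz_leUr /=.
rewrite -(rz_leD2 (- z)) addrK rjoinP -(rz_leD2 z x) -(rz_leD2 z y) !subrK.
by rewrite rz_leUl rz_leUr.
Qed.

Lemma rjoinZ (a : R) x y : 0 < a -> rjoin (a *: x) (a *: y) = a *: rjoin x y.
Proof.
move=> a0; have ai0 : 0 < a^-1 by rewrite invr_gt0.
apply: le_anti; rewrite rjoinP !rz_scale_le// rz_leUl rz_leUr /=.
rewrite -(rz_scale_le _ _ ai0) scalerA mulVf ?gt_eqF// scale1r rjoinP.
rewrite -(rz_scale_le x _ a0) -(rz_scale_le y _ a0) !scalerA mulfV ?gt_eqF//.
by rewrite !scale1r rz_leUl rz_leUr.
Qed.

Lemma rabsE x : rabs x = x + 2 *: rneg x.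
Proof.
rewrite /rneg -rjoinZ// addrC -rjoinDr scaler0 add0r rjoinC /rabs.
by rewrite scaler_nat mulr2n -addrA addNr addr0.
Qed.

Lemma rabs_ge0 x : 0 <= rabs x.
Proof.
rewrite -(rz_scale_pos_ge0 _ (_ : 0 < 2 :> R))// scaler_nat mulr2n.
by rewrite -(subrr x) rz_leD ?rz_leUl ?rz_leUr.
Qed.

Lemma rz_sub_le x y z : (x - y <= z) = (x <= z + y).
Proof. by rewrite -(rz_leD2 y (x - y)) subrK. Qed.

End RieszTheory.

(* The unitization E (+) R; the pair (x, a) stands for x + a. *)
Definition unitization (R : realType) (E : truncRieszType R) : Type :=
  (E * R)%type.

Section Unitization.
Context {R : realType} {E : truncRieszType R}.
Local Notation U := (unitization E).
Implicit Types (x y p q : E) (a b : R) (u v w : U).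

HB.instance Definition _ := GRing.Lmodule.copy U (E * R^o)%type.

Definition unit_in x : U := (x, 0).
Definition unit_one : U := (0, 1).

Definition unit_nneg u : bool :=
  ((u.2 == 0) && (0 <= u.1)) ||
  ((0 < u.2) && (trunc (u.2^-1 *: rneg u.1) == u.2^-1 *: rneg u.1)).

Definition unit_abs u : U :=
  if u.2 == 0 then (rabs u.1, 0) else
  (rabs u.1 - (2 * `|u.2|) *:
     trunc (rjoin (u.2^-1 *: rneg u.1) ((- u.2^-1) *: rpos u.1)), `|u.2|).

Definition unit_le u v : bool := unit_nneg (v - u).
Definition unit_join u v : U := 2^-1 *: (u + v + unit_abs (u - v)).
Definition unit_meet u v : U := 2^-1 *: (u + v - unit_abs (u - v)).

Definition trunc_fixed p := 0 <= p /\ trunc p = p.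

Lemma trunc_fixed_trunc x : 0 <= x -> trunc_fixed (trunc x).
Proof.
move=> x0; have t0 := trunc_ge0 x x0; split=> //; apply: le_anti.
rewrite trunc_le//=.
by have := trunc_ge_meet (trunc x) x t0 x0; rewrite rmeet_l.
Qed.

Lemma trunc_fixed0 : trunc_fixed 0.
Proof. by split=> //; apply: le_anti; rewrite trunc_le// trunc_ge0. Qed.

#[local] Hint Resolve trunc_fixed0 : core.

Lemma trunc_fixed_le x p : trunc_fixed p -> 0 <= x -> x <= p -> trunc_fixed x.
Proof.
move=> [p0 pE] x0 xp; split=> //; apply: le_anti; rewrite trunc_le//=.
have := trunc_ge_meet x p x0 p0.
by rewrite pE rmeet_l.
Qed.

Lemma trunc_fixed_join p q : trunc_fixed p -> trunc_fixed q -> trunc_fixed (rjoin p q).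
Proof.
move=> [p0 pE] [q0 qE].
have j0 : 0 <= rjoin p q by exact: le_trans p0 (rz_leUl _ _).
split=> //; apply: le_anti; rewrite trunc_le//= rjoinP.
have := trunc_ge_meet (rjoin p q) p j0 p0.
have := trunc_ge_meet (rjoin p q) q j0 q0.
by rewrite pE qE !rmeet_r ?rz_leUl ?rz_leUr// => -> ->.
Qed.

Lemma trunc_fixed_max x p : trunc_fixed p -> 0 <= x -> p <= x -> p <= trunc x.
Proof.
move=> [p0 pE] x0 px; have := trunc_ge_meet x p x0 p0.
by rewrite pE rmeet_r.
Qed.

Lemma unit_nnegP u :
  reflect (0 <= u.2 /\ exists2 p, trunc_fixed p & 0 <= u.1 + u.2 *: p) (unit_nneg u).
Proof.
case: u => x a /=; rewrite /unit_nneg /=; apply: (iffP idP).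
  case/orP => /andP[].
    by move=> /eqP -> x0; split=> //; exists 0; rewrite // scaler0 addr0.
  move=> a0 /eqP e; split; first exact: ltW.
  have n0 : 0 <= rneg x by exact: rz_leUr.
  exists (a^-1 *: rneg x).
    by split=> //; rewrite rz_scale_ge0// invr_ge0 ltW.
  rewrite scalerA mulfV ?gt_eqF// scale1r addrC -[x in _ + x]opprK rz_subr_ge0.
  exact: rz_leUl.
case; rewrite le_eqVlt => /orP[/eqP <- [p _]|a0 [p fp]].
  by rewrite scale0r addr0 eqxx => ->.
move=> h; rewrite a0 [X in _ || X]/= orbC; apply/orP; left.
have n0 : 0 <= rneg x by exact: rz_leUr.
apply/eqP; apply: (proj2 (trunc_fixed_le fp _ _)).
  by rewrite rz_scale_ge0// invr_ge0 ltW.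
rewrite -(rz_scale_le _ _ a0) scalerA mulfV ?gt_eqF// scale1r rjoinP.
rewrite -(rz_subr_ge0 (- x)) opprK addrC h /= rz_scale_ge0 ?(ltW a0)//.
by case: fp.
Qed.

Lemma unit_nnegD u v : unit_nneg u -> unit_nneg v -> unit_nneg (u + v).
Proof.
case: u v => [x a] [y b] /unit_nnegP /= [a0 [p fp xp]] /unit_nnegP /= [b0 [q fq yq]].
apply/unit_nnegP; split; first exact: addr_ge0.
exists (rjoin p q); first exact: trunc_fixed_join.
apply: (le_trans (rz_addr_ge0 xp yq)) => /=; rewrite addrACA.
apply: rz_leD => //; rewrite scalerDl.
by apply: rz_leD; apply: rz_scale_wle => //; [exact: rz_leUl|exact: rz_leUr].
Qed.

Lemma unit_nnegZ a u : 0 <= a -> unit_nneg u -> unit_nneg (a *: u).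
Proof.
move=> a0; case: u => [x b] /unit_nnegP /= [b0 [p fp xp]]; apply/unit_nnegP => /=.
split; first exact: mulr_ge0.
by exists p => //; rewrite -scalerA -scalerDr rz_scale_ge0.
Qed.

Lemma unit_nnegZp a u : 0 < a -> unit_nneg (a *: u) = unit_nneg u.
Proof.
move=> a0; apply/idP/idP; last exact/unit_nnegZ/ltW.
have ai0 : 0 <= a^-1 by rewrite invr_ge0 ltW.
by move=> /(unit_nnegZ ai0); rewrite scalerA mulVf ?gt_eqF// scale1r.
Qed.

Lemma unit_le_refl : reflexive unit_le.
Proof. by move=> u; rewrite /unit_le subrr; rewrite /unit_nneg /= eqxx lexx. Qed.

Lemma unit_le_anti : antisymmetric unit_le.
Proof.
move=> u v; rewrite /unit_le => /andP[h k].
suff : v - u = 0 by move/eqP; rewrite subr_eq0 => /eqP.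
move: h k; rewrite -(opprB v u); case: (v - u) => x a.
move=> /unit_nnegP/= [a0 [p _ h]] /unit_nnegP/= [a0' [q _ k]].
have a_eq0 : a = 0 by apply: le_anti; rewrite a0 -oppr_ge0 a0'.
move: h k; rewrite a_eq0 oppr0 !scale0r !addr0 => x0 x0'.
congr pair; apply: le_anti; rewrite x0 andbT.
by rewrite -rz_subr_ge0 add0r.
Qed.

Lemma unit_le_trans : transitive unit_le.
Proof.
move=> v u w; rewrite /unit_le => h k.
by have := unit_nnegD h k; rewrite addrC addrA subrK.
Qed.

HB.instance Definition _ := Order.Le_isPOrder.Build ring_display U
  unit_le_refl unit_le_anti unit_le_trans.

Lemma unit_leE u v : (u <= v) = unit_nneg (v - u).
Proof. by []. Qed.

Lemma unit_ge0E u : (0 <= u) = unit_nneg u.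
Proof. by rewrite unit_leE subr0. Qed.

Lemma unit_absN u : unit_abs (- u) = unit_abs u.
Proof.
case: u => x a; rewrite /unit_abs /= oppr_eq0.
have [a0|a0] := eqVneq a 0.
  by rewrite /rabs opprK rjoinC.
rewrite normrN; congr pair; congr (_ - _ *: trunc _).
  by rewrite /rabs opprK rjoinC.
by rewrite invrN opprK /rneg /rpos opprK rjoinC.
Qed.

Lemma unit_abs_lub_pos w z : 0 <= w.2 ->
  (unit_abs w <= z) = (w <= z) && (- w <= z).
Proof.
case: w z => x a [y b] /=; rewrite le_eqVlt => /orP[/eqP <-|a0].
  rewrite !unit_leE /unit_abs /= eqxx.
  have E1 c : ((y, b) : U) - ((c, 0) : U) = (y - c, b).
    by congr pair; rewrite /= subr0.
  rewrite (E1 x) (E1 (rabs x)).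
  have -> : - ((x, 0) : U) = (- x, 0) by congr pair; rewrite /= oppr0.
  rewrite E1; apply/unit_nnegP/andP => /=.
    move=> [b0 [p fp h]]; split; apply/unit_nnegP => /=; split=> //; exists p => //;
      apply: (le_trans h); apply: rz_leD => //; apply: rz_leD => //.
      by rewrite rz_leN2; exact: rz_leUl.
    by rewrite rz_leN2; exact: rz_leUr.
  case=> /unit_nnegP/= [b0 [p fp h]] /unit_nnegP/= [_ [q fq k]]; split=> //.
  exists (rjoin p q); first exact: trunc_fixed_join.
  rewrite addrAC rz_subr_ge0 rjoinP -!(rz_subr_ge0 _ (y + _)).
  apply/andP; split; rewrite addrAC.
    apply: (le_trans h); apply: rz_leD => //.
    by apply: rz_scale_wle => //; exact: rz_leUl.
  apply: (le_trans k); apply: rz_leD => //.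
  by apply: rz_scale_wle => //; exact: rz_leUr.
set q := trunc (a^-1 *: rneg x).
have ai0 : 0 <= a^-1 by rewrite invr_ge0 ltW.
have n0 : 0 <= rneg x by exact: rz_leUr.
have an0 : 0 <= a^-1 *: rneg x by exact: rz_scale_ge0.
have absE : unit_abs (x, a) = (rabs x - (2 * a) *: q, a).
  rewrite /unit_abs /= gt_eqF// gtr0_norm//; congr (_ - _ *: trunc _, _).
  apply: rjoin_l; rewrite scaleNr.
  apply: (le_trans (_ : _ <= 0)) => //.
  by rewrite -rz_subr_ge0 sub0r opprK rz_scale_ge0//; exact: rz_leUr.
have fq : trunc_fixed q by exact: trunc_fixed_trunc.
have aq : a *: q <= rneg x.
  have /(rz_scale_wle (ltW a0)) := trunc_le _ an0.
  by rewrite scalerA mulfV ?gt_eqF// scale1r.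
rewrite absE; apply/idP/andP => [h|[]].
  have le1 : ((x, a) : U) <= (rabs x - (2 * a) *: q, a).
    rewrite unit_leE; apply/unit_nnegP => /=; rewrite subrr; split=> //.
    exists 0; rewrite // scaler0 addr0 rabsE -scalerA.
    rewrite addrAC [x + _]addrC addrK -scalerBr rz_scale_ge0//.
    by rewrite rz_subr_ge0.
  have le2 : - ((x, a) : U) <= (rabs x - (2 * a) *: q, a).
    rewrite unit_leE; apply/unit_nnegP => /=; rewrite opprK.
    split; first by rewrite addr_ge0 ?ltW.
    exists q => //; rewrite -mulr2n -[a *+ 2]mulr_natl addrAC subrK.
    by rewrite rz_subr_ge0; exact: rz_leUr.
  by split; [exact: le_trans le1 h|exact: le_trans le2 h].
rewrite !unit_leE.
move=> /unit_nnegP/= [ba [p1 fp1 h1]] /unit_nnegP/=; rewrite !opprK => -[ba' [p2 fp2 h2]].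
apply/unit_nnegP => /=; split=> //.
pose p := rjoin p1 p2; have fp : trunc_fixed p by exact: trunc_fixed_join.
exists p => //.
have {}h1 : 0 <= y - x + (b - a) *: p.
  apply: (le_trans h1); apply: rz_leD => //.
  by apply: rz_scale_wle => //; exact: rz_leUl.
have {}h2 : 0 <= y + x + (b + a) *: p.
  apply: (le_trans h2); apply: rz_leD => //.
  by apply: rz_scale_wle => //; exact: rz_leUr.
(* x^- /\ a p <= a q *)
have key : rmeet (rneg x) (a *: p) <= a *: q.
  rewrite -(rz_scale_le _ _ (_ : 0 < a^-1)) ?invr_gt0//.
  rewrite scalerA mulVf ?gt_eqF// scale1r.
  have m0 : 0 <= rmeet (rneg x) (a *: p).
    by rewrite rmeetP n0/= rz_scale_ge0 ?(ltW a0)//; case: fp.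
  apply: trunc_fixed_max => //; last by apply: rz_scale_wle => //; exact: rz_leIl.
  apply: (trunc_fixed_le fp); first exact: rz_scale_ge0.
  rewrite -(rz_scale_le _ _ a0) scalerA mulfV ?gt_eqF// scale1r; exact: rz_leIr.
set Y := y + (b - a) *: p.
have xY : x <= Y by rewrite -rz_subr_ge0 /Y addrAC.
have xY2 : - x - Y <= (2 * a) *: p.
  have ba2 : b + a = (b - a) + 2 * a by rewrite mulr_natl mulr2n addrA subrK.
  rewrite rz_sub_le -(rz_subr_ge0 (- x)) opprK addrC [_ *: p + Y]addrC /Y.
  by rewrite -[y + _ + _]addrA -scalerDl -ba2 addrA [x + y]addrC.
have q0 : 0 <= q by case: fq.
have a20 : 0 <= 2 * a by rewrite mulr_ge0// ltW.
rewrite opprB addrAC -/Y addrA rz_subr_ge0 rjoinP; apply/andP; split.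
  by rewrite -[x]addr0 rz_leD// rz_scale_ge0.
rewrite addrC -rz_sub_le; apply: (le_trans (_ : _ <= 2 *: (a *: q))); last first.
  by rewrite scalerA.
apply: (le_trans (_ : _ <= 2 *: rmeet (rneg x) (a *: p))); last first.
  by rewrite rz_scale_le.
have i20 : (0 : R) < 2^-1 by rewrite invr_gt0.
rewrite -(rz_scale_le _ _ i20) scalerA mulVf ?pnatr_eq0// scale1r rmeetP.
rewrite -!(rz_scale_le (2^-1 *: _) _ (_ : 0 < 2))// !scalerA mulfV ?pnatr_eq0// scale1r xY2.
rewrite andbT /rneg -rjoinZ//; apply: le_trans (rz_leUl _ _).
by rewrite scaler_nat mulr2n rz_leD// rz_leN2.
Qed.

Lemma unit_abs_lub w z : (unit_abs w <= z) = (w <= z) && (- w <= z).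
Proof.
have [w0|/ltW w0] := leP 0 w.2; first exact: unit_abs_lub_pos.
by rewrite -unit_absN unit_abs_lub_pos /= ?oppr_ge0// opprK andbC.
Qed.

Lemma unit_leD2 t u v : u <= v -> u + t <= v + t.
Proof. by rewrite !unit_leE opprD addrACA subrr addr0. Qed.

Lemma unit_scale_ge0 a u : 0 <= a -> 0 <= u -> 0 <= a *: u.
Proof. by rewrite !unit_ge0E; exact: unit_nnegZ. Qed.

Lemma unit_joinP u v z : (unit_join u v <= z) = (u <= z) && (v <= z).
Proof.
have i20 : (0 : R) < 2^-1 by rewrite invr_gt0.
have -> : (unit_join u v <= z) = (unit_abs (u - v) <= 2 *: z - (u + v)).
  rewrite !unit_leE -(unit_nnegZp (2 *: z - _ - _) i20) !scalerBr scalerA mulVf ?pnatr_eq0//.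
  by rewrite scale1r /unit_join scalerDr opprD addrA.
have e t s : (t - s <= 2 *: z - (t + s)) = (t <= z).
  rewrite !unit_leE -(unit_nnegZp (z - t) (_ : 0 < 2))//; congr unit_nneg.
  rewrite scalerBr !scaler_nat !mulr2n opprB opprD -!addrA; congr (_ + (_ + _)).
  by rewrite addKr opprD.
by rewrite unit_abs_lub opprB e [u + v]addrC e.
Qed.

Lemma unit_meetE u v : unit_meet u v = - unit_join (- u) (- v).
Proof.
rewrite /unit_meet /unit_join -scalerN; congr (_ *: _).
by rewrite !opprD !opprK -[in RHS]unit_absN opprD opprK.
Qed.

Lemma unit_leN2 u v : (- u <= - v) = (v <= u).
Proof. by rewrite !unit_leE opprK addrC. Qed.

Lemma unit_meetP u v z : (u <= unit_meet v z) = (u <= v) && (u <= z).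
Proof.
by rewrite unit_meetE -unit_leN2 opprK unit_joinP !unit_leN2.
Qed.

HB.instance Definition _ := isRiesz.Build R U unit_leD2 unit_scale_ge0
  unit_meetP unit_joinP.

(* unit_join and unit_meet are built from the explicit formula unit_abs; the
   lattice absolute value they induce is that formula again. *)
Lemma unit_rabsE u : rabs u = unit_abs u.
Proof.
by apply: le_anti; rewrite rjoinP unit_abs_lub rz_leUl rz_leUr -unit_abs_lub lexx.
Qed.

Lemma unit_in_le x y : (unit_in x <= unit_in y) = (x <= y).
Proof. by rewrite unit_leE /unit_nneg /= subrr eqxx ltxx orbF rz_subr_ge0. Qed.

Lemma unit_in_rabs x : rabs (unit_in x) = unit_in (rabs x).
Proof. by rewrite unit_rabsE /unit_abs eqxx. Qed.

Lemma unit_in_trunc x : 0 <= x ->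
  unit_in (trunc x) = rmeet unit_one (unit_in x).
Proof.
move=> x0; have ft := trunc_fixed_trunc x0; apply: le_anti; rewrite rmeetP unit_in_le.
rewrite trunc_le// andbT; apply/andP; split.
  by apply/unit_nnegP => /=; rewrite subr0 ler01; split=> //; exists (trunc x);
    rewrite // scale1r sub0r addNr.
have := rz_leIr unit_one (unit_in x); have := rz_leIl unit_one (unit_in x).
case: (rmeet _ _) => y b.
rewrite !unit_leE => /unit_nnegP/= [b1 [p fp h]] /unit_nnegP/= [b0 [q fq k]].
apply/unit_nnegP => /=; split=> //; pose r := rjoin p q.
have fr : trunc_fixed r by exact: trunc_fixed_join.
exists r => //.
have r0 : 0 <= r by case: fr.
have {}h : y + b *: r <= r.
  rewrite -(rz_subr_ge0 (_ + _)) opprD addrCA -{1}[r]scale1r -scalerBl.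
  rewrite sub0r in h; apply: (le_trans h); rewrite rz_leD//.
  by apply: rz_scale_wle => //; exact: rz_leUl.
have {}k : y + b *: r <= x.
  rewrite -(rz_subr_ge0 (_ + _)) opprD addrA -scaleNr -[- b]sub0r.
  apply: (le_trans k); rewrite rz_leD//.
  by apply: rz_scale_wle => //; exact: rz_leUr.
rewrite sub0r scaleNr -addrA -opprD rz_subr_ge0.
apply: le_trans (trunc_ge_meet _ _ x0 r0); rewrite rmeetP k.
by case: fr => _ ->.
Qed.

End Unitization.

Section Norms.
Context {R : realType}.

Record is_lattice_norm (E : rieszType R) (N : E -> R) : Prop := {
  lnorm_triangle : forall x y, N (x + y) <= N x + N y;
  lnormZ : forall (a : R) x, N (a *: x) = `|a| * N x;
  lnorm_eq0 : forall x, N x = 0 -> x = 0;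
  lnorm_mono : forall x y, rabs x <= rabs y -> N x <= N y
}.

Definition trunc_norms (E : truncRieszType R) (N : E -> R) : set R :=
  [set N (trunc x) | x in [set x : E | 0 <= x]].

(* has_ubound is stated because sup is 0 on unbounded sets. *)
Record is_trunc_norm (E : truncRieszType R) (N : E -> R) : Prop := {
  tnorm_lattice : is_lattice_norm N;
  tnorm_bounded : has_ubound (trunc_norms N);
  tnorm_sup : sup (trunc_norms N) = 1
}.

Record is_unitization_norm (E : truncRieszType R) (N : E -> R)
    (Nu : unitization E -> R) : Prop := {
  unorm_lattice : is_lattice_norm Nu;
  unorm_ext : forall x, Nu (unit_in x) = N x;
  unorm1 : Nu unit_one = 1
}.

Definition norm_dense (E : rieszType R) (N : E -> R) (A : set E) : Prop :=
  forall u eps, 0 < eps -> exists2 v, A v & N (u - v) < eps.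

Definition norm0_set (E : truncRieszType R) (N : E -> R)
    (u : unitization E) : set R :=
  [set N y | y in [set y : E | rabs (unit_in y) <= rabs u]].

Definition norm0 (E : truncRieszType R) (N : E -> R) (u : unitization E) : R :=
  sup (norm0_set N u).

(* The supremum defining norm0 is a genuine one. *)
Lemma norm0_has_sup (E : truncRieszType R) (N : E -> R)
    (Nu : unitization E -> R) u :
  is_unitization_norm N Nu -> has_sup (norm0_set N u).
Proof.
move=> uN; split; last first.
  exists (Nu u) => _ [y /= yu <-].
  by rewrite -(unorm_ext uN); exact: lnorm_mono (unorm_lattice uN) _ _ yu.
exists (N 0), 0 => //=; apply: le_trans (rabs_ge0 u).
rewrite unit_in_rabs /rabs oppr0 rjoin_l//.
Qed.

End Norms.

(* Main.v *)
Require Import Defs.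
From mathcomp Require Import all_boot all_order all_algebra.
From mathcomp Require Import boolp classical_sets reals.

(** [E] is not just a Riesz subspace but an ideal of its unitization: a vector
    whose absolute value is dominated by an element of [E] has scalar part [0].
    For a norm-dense ideal, every vector [u] is approximated from below: if [y]
    lies in the ideal and is close to [|u|], then so is [|u| /\ |y|], which lies
    in the ideal and below [|u|] (lemma [dense_solid_below]).  As a unitization
    norm agrees with [N] on [E], this says exactly that it is the supremum
    [norm0].

    A truncation unit [e] would satisfy [e = 1 /\ e <= 1], and no nonzero
    [z >= 0] of [E] could lie below [1 - e]: otherwise
    [z + e = 1 /\ (z + e) = e /\ (z + e) <= e].  Approximation of [1 - e] from
    below then gives it norm [0], hence [1 = e], although [1] is not in [E]. *)

Set Implicit Arguments.
Unset Strict Implicit.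
Unset Printing Implicit Defensive.

Import Order.TTheory GRing.Theory Num.Theory.
Local Open Scope classical_set_scope.
Local Open Scope ring_scope.

Section RieszNorm.
Context {R : realType} {E : rieszType R}.
Implicit Types (x y u v : E) (A : set E) (N : E -> R).

Lemma rabs_id x : 0 <= x -> rabs x = x.
Proof. by move=> x0; apply/rjoin_l/(le_trans _ x0); rewrite -oppr0 rz_leN2. Qed.

Lemma rabs_le0 x : rabs x <= 0 -> x = 0.
Proof.
rewrite rjoinP => /andP[x0 x0']; apply: le_anti.
by rewrite x0 -rz_leN2 oppr0.
Qed.

Lemma lnorm0 N : is_lattice_norm N -> N 0 = 0.
Proof. by move=> hN; rewrite -(scale0r 0) (lnormZ hN) normr0 mul0r. Qed.

Lemma lnorm_rabs N x : is_lattice_norm N -> N (rabs x) = N x.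
Proof.
move=> hN; have xx := rabs_id (rabs_ge0 x).
by apply: le_anti; rewrite !(lnorm_mono hN) ?xx.
Qed.

(** If [y] in [A] is within [eps] of [|u|], the witness is [|u| /\ |y|], since
    [0 <= |u| - |u| /\ |y| <= | |u| - y |]. *)
Lemma dense_solid_below N A u eps :
  is_lattice_norm N -> norm_dense N A ->
  (forall x y, A y -> rabs x <= rabs y -> A x) ->
  0 < eps -> exists v, [/\ A v, rabs v <= rabs u & N u < N v + eps].
Proof.
move=> hN dA sA eps0; have [y Ay yeps] := dA (rabs u) eps eps0.
pose v := rmeet (rabs u) (rabs y).
have v0 : 0 <= v by rewrite rmeetP !rabs_ge0.
have d0 : 0 <= rabs u - v by rewrite rz_subr_ge0 rz_leIl.
have dle : rabs u - v <= rabs (rabs u - y).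
  rewrite rz_sub_le addrC -rz_sub_le rmeetP; apply/andP; split.
    by rewrite rz_sub_le -{1}[rabs u]addr0 rz_leD ?rabs_ge0.
  rewrite rz_sub_le -{1}[rabs u](subrK y) addrC.
  by apply: rz_leD; exact: rz_leUl.
exists v; split.
- by apply: (sA _ y) => //; rewrite rabs_id// rz_leIr.
- by rewrite rabs_id// rz_leIl.
rewrite -(lnorm_rabs u hN) -{1}(subrK v (rabs u)) addrC.
apply: (le_lt_trans (lnorm_triangle hN _ _)); rewrite ltrD2l.
by apply: le_lt_trans yeps; apply: (lnorm_mono hN); rewrite (rabs_id d0).
Qed.

End RieszNorm.

Section UnitizationIdeal.
Context {R : realType} {E : truncRieszType R}.
Implicit Types (x y : E) (u v : unitization E).

Lemma unit_le_snd u v : u <= v -> u.2 <= v.2.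
Proof. by rewrite unit_leE => /unit_nnegP[]; rewrite subr_ge0. Qed.

Lemma unit_in_solid u v :
  range (@unit_in R E) v -> rabs u <= rabs v -> range (@unit_in R E) u.
Proof.
move=> [y _ <-]; rewrite unit_in_rabs rjoinP.
move=> /andP[/unit_le_snd /= u0 /unit_le_snd /= u0'].
have u2 : u.2 = 0 by apply: le_anti; rewrite u0 -oppr_le0.
by exists u.1 => //; case: u u2 {u0 u0'} => x a /= ->.
Qed.

Lemma unit_inD x y : unit_in (x + y) = unit_in x + unit_in y.
Proof. by congr pair; rewrite /= addr0. Qed.

Lemma unit_in0 : unit_in 0 = 0 :> unitization E.
Proof. by []. Qed.

Lemma truncation_unit_le1 (e : E) :
  is_truncation_unit e -> unit_in e <= unit_one.
Proof.
move=> [/ltW e0 eE]; have := unit_in_trunc e0.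
by rewrite eE// rmeet_l// => ->; exact: rz_leIl.
Qed.

(** On [E] the elements [e] and [1] have the same meets, so [1 - e] is disjoint
    from [E]. *)
Lemma truncation_unit_below (e x : E) :
  is_truncation_unit e -> rabs (unit_in x) <= unit_one - unit_in e -> x = 0.
Proof.
move=> [/ltW e0 eE]; rewrite unit_in_rabs -(rz_leD2 (unit_in e)) subrK -unit_inD.
move=> xe1; have xe0 : 0 <= rabs x + e by rewrite rz_addr_ge0 ?rabs_ge0.
have : rabs x + e <= e.
  rewrite -unit_in_le -(rmeet_r xe1) -unit_in_trunc// unit_in_le eE//.
  exact: rz_leIl.
by rewrite -{2}[e]add0r rz_leD2; exact: rabs_le0.
Qed.

End UnitizationIdeal.

Theorem theorem3p3 (R : realType) (E : truncRieszType R) (N : E -> R)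
    (Nu : unitization E -> R)
    (hN : is_trunc_norm N) (hNu : is_unitization_norm N Nu)
    (hdense : norm_dense Nu (range (@unit_in R E))) :
  ~ (exists e : E, is_truncation_unit e) /\
  (forall u : unitization E, Nu u = norm0 N u).
Proof.
have hL := unorm_lattice hNu.
have below u eps : 0 < eps ->
    exists2 y, rabs (unit_in y) <= rabs u & Nu u < N y + eps.
  move=> eps0.
  have solid (v w : unitization E) := @unit_in_solid R E v w.
  have [_ [[y _ <-] yu]] := dense_solid_below u hL hdense solid eps0.
  by rewrite (unorm_ext hNu); exists y.
split=> [[e he]|u].
  pose d : unitization E := unit_one - unit_in e.
  have d0 : 0 <= d by rewrite rz_subr_ge0 truncation_unit_le1.
  have Nd_le0 : Nu d <= 0.
    apply/ler_addgt0Pr => eps eps0; have [y yd /ltW] := below d eps eps0.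
    rewrite (rabs_id d0) in yd.
    rewrite (truncation_unit_below he yd) -(unorm_ext hNu) unit_in0.
    by rewrite (lnorm0 hL).
  have Nd_ge0 : 0 <= Nu d.
    rewrite -(lnorm0 hL); apply: (lnorm_mono hL).
    by rewrite rabs_id// rabs_ge0.
  have /(congr1 snd) /= : d = 0.
    by apply: (lnorm_eq0 hL); apply: le_anti; rewrite Nd_le0.
  by move/eqP; rewrite subr0 oner_eq0.
have hs := norm0_has_sup u hNu.
apply: le_anti; apply/andP; split.
  apply/ler_addgt0Pr => eps eps0; have [y yu /ltW/le_trans] := below u eps eps0.
  apply; rewrite lerD2r; apply: ub_le_sup; first exact: (proj2 hs).
  by exists y.
apply: ge_sup; first exact: (proj1 hs).
by move=> _ [y yu <-]; rewrite -(unorm_ext hNu); exact: (lnorm_mono hL).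
Qed.
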